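(* Let $\gamma$ be the size of a string attractor for a string $S$ of length $n$ over an integer alphabet. Then, for every $2\le\tau\le n/\gamma$, there is a data structure of size $O(\tau\gamma\log_\tau(n/\gamma))$ words supporting partial sum queries $S.psum(i)=\sum_{j=1}^{i}S[j]$ in $O(\log_\tau(n/\gamma))$ time.
   Context: A string attractor of $S\in\Sigma^n$ is a set $\Gamma\subseteq[1..n]$ such that every substring $S[i..j]$ has an occurrence $S[i'..j']=S[i..j]$ with some $j''\in\Gamma\cap[i'..j']$. Model: word RAM with words of $\Theta(\log n)$ bits. *)

(* Defs.v *)
From HB Require Import structures.
From mathcomp Require Import all_boot all_order all_algebra.
From mathcomp Require Import reals exp.

Set Implicit Arguments.
Unset Strict Implicit.
Unset Printing Implicit Defensive.

Import Order.TTheory GRing.Theory Num.Theory.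

Local Open Scope nat_scope.

Definition logb (R : realType) (b x : R) : R := (ln x / ln b)%R.

(* Positions are 0-based: [substr S i j] is the substring with first position
   [i] and last position [j], both included. *)
Definition substr (T : Type) (S : seq T) (i j : nat) : seq T :=
  take (j.+1 - i) (drop i S).

Definition string_attractor (T : Type) (n : nat) (S : n.-tuple T)
    (Gamma : {set 'I_n}) : Prop :=
  forall i j : 'I_n, i <= j ->
    exists i' j' : 'I_n,
      [/\ i' <= j', substr S i' j' = substr S i j
        & exists2 k : 'I_n, k \in Gamma & i' <= k <= j'].

(* S[1] + ... + S[i] with 1-based positions, i.e. the first [i] entries. *)
Definition psum (n : nat) (S : n.-tuple int) (i : nat) : int :=
  (\sum_(j < n | (j < i)%N) tnth S j)%R.

(* Word RAM with [W]-bit words. A word is a natural number below 2 ^ W. The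
   registers are indexed by nat, but a program, being a finite list, names only
   finitely many of them. Jump targets are absolute instruction indices. *)
Inductive binop :=
| OpAdd | OpSub | OpMul | OpDiv | OpMod | OpAnd | OpOr | OpXor | OpShl | OpShr.

Inductive instr :=
| Const (r v : nat)                (* r := v               *)
| Move (r a : nat)                 (* r := a               *)
| Op (o : binop) (r a b : nat)     (* r := a o b           *)
| Read (r a : nat)                 (* r := cells[a]        *)
| Write (a b : nat)                (* cells[a] := b        *)
| Jump (l : nat)
| JumpLt (a b l : nat)             (* if a < b then goto l *)
| JumpEq (a b l : nat)             (* if a = b then goto l *)
| Halt.

Definition program := seq instr.

Record state := State { pc : nat; regs : nat -> nat; cells : seq nat }.

(* OpSub is subtraction modulo 2 ^ W, not truncated subtraction; division by 0
   gives 0. *)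
Definition eval_op (W : nat) (o : binop) (x y : nat) : nat :=
  match o with
  | OpAdd => x + y
  | OpSub => x + (2 ^ W - y)
  | OpMul => x * y
  | OpDiv => x %/ y
  | OpMod => x %% y
  | OpAnd => Nat.land x y
  | OpOr => Nat.lor x y
  | OpXor => Nat.lxor x y
  | OpShl => x * 2 ^ y
  | OpShr => x %/ 2 ^ y
  end %% 2 ^ W.

Definition upd (f : nat -> nat) (r v : nat) : nat -> nat :=
  fun x => if x == r then v else f x.

Definition fetch (P : program) (s : state) : instr := nth Halt P (pc s).

(* The memory has a fixed number of cells: reading outside of it gives 0 and
   writing outside of it has no effect. Thus besides its finitely many registers
   a program has no storage other than the cells it is started with. *)
Definition step (W : nat) (P : program) (s : state) : state :=
  let: State p f m := s in
  match fetch P s with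
  | Const r v => State p.+1 (upd f r (v %% 2 ^ W)) m
  | Move r a => State p.+1 (upd f r (f a)) m
  | Op o r a b => State p.+1 (upd f r (eval_op W o (f a) (f b))) m
  | Read r a => State p.+1 (upd f r (nth 0 m (f a))) m
  | Write a b =>
      State p.+1 f (if f a < size m then set_nth 0 m (f a) (f b) else m)
  | Jump l => State l f m
  | JumpLt a b l => State (if f a < f b then l else p.+1) f m
  | JumpEq a b l => State (if f a == f b then l else p.+1) f m
  | Halt => s
  end.

Definition halted (P : program) (s : state) : bool :=
  if fetch P s is Halt then true else false.

(* The query is passed in register 0; all other registers start at 0. *)
Definition init (W : nat) (D : seq nat) (q : nat) : state :=
  State 0 (upd (fun=> 0) 0 (q %% 2 ^ W)) D.

Definition run (W : nat) (P : program) (D : seq nat) (q t : nat) : state :=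
  iter t (step W P) (init W D q).

(* Two's complement reading of a word. *)
Definition sword (W w : nat) : int :=
  if w < 2 ^ W.-1 then Posz w else (Posz w - Posz (2 ^ W)%N)%R.

Definition is_memory (W : nat) (D : seq nat) : bool :=
  all (fun w => w < 2 ^ W) D.

(* Started on the data structure [D] and the query [q], the program [P] has
   stopped after at most [t] instructions with answer [v] in register 0. It must
   leave [D] as it was, so that [D] can serve any sequence of queries. *)
Definition answers (W : nat) (P : program) (D : seq nat) (q t : nat) (v : int)
    : Prop :=
  let s := run W P D q t in
  [/\ halted P s, cells s = D & sword W (regs s 0) = v].

(* Main.v *)
Require Import Defs.
From mathcomp Require Import all_boot all_order all_algebra.
From mathcomp Require Import zify lra reals exp.

(** Let [t] be the integer part of [tau] and [m] the least exponent with
    [n <= #|Gamma| * t ^ m]. The string is cut into blocks of length [t ^ m]; for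
    every [k < m] and every attractor position [p], the window of radius
    [t ^ k.+1] around [p] is cut into [2 * t] blocks of length [t ^ k]. A block
    of length [t ^ k.+1] starting at [a] has a copy, starting at [i], that
    contains an attractor position, hence lies in one of these windows, and
      [psum (a + l) - psum a = psum (i + l) - psum i].
    So a block that stores its window, the offset of [i] in it and
    [psum a - psum i] reduces a query to one at the next level; a block of length
    one stores [psum a]. Sums are kept modulo [2 ^ W]: only the final answer has
    to fit in a word. *)

Set Implicit Arguments.
Unset Strict Implicit.
Unset Printing Implicit Defensive.

Import Order.TTheory GRing.Theory Num.Theory.

Local Open Scope nat_scope.

(** * Two's complement encoding of integers modulo [2 ^ W] *)

Definition word (W : nat) (z : int) : nat := `|(z %% Posz (2 ^ W)%N)%Z|.

Lemma word_lt W z : word W z < 2 ^ W.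
Proof.
have W0 : (2 ^ W)%N != 0 by rewrite expn_eq0.
have := ltz_pmod z (d := Posz (2 ^ W)%N); have := modz_ge0 z (d := Posz (2 ^ W)%N).
rewrite /word; lia.
Qed.

Lemma PoszK_word W z : Posz (word W z) = (z %% Posz (2 ^ W)%N)%Z.
Proof. by rewrite /word gez0_abs // modz_ge0 // eqz_nat expn_eq0. Qed.

Lemma wordD W y z : (word W y + word W z) %% 2 ^ W = word W (y + z)%R.
Proof.
have /eqP : Posz ((word W y + word W z) %% 2 ^ W)%N = Posz (word W (y + z)%R).
  by rewrite -modz_nat PoszD !PoszK_word modzDml modzDmr.
by rewrite eqz_nat => /eqP.
Qed.

Lemma word0 W : word W 0 = 0.
Proof. by rewrite /word mod0z. Qed.

Lemma sword_word W z : 0 < W -> `|z| < 2 ^ W.-1 -> sword W (word W z) = z.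
Proof.
case: W => // W _ /= zW; rewrite /sword /=.
have e2 : (2 ^ W.+1 = 2 * 2 ^ W)%N by rewrite expnS.
have h := PoszK_word W.+1 z; move: h; set w := word _ z; rewrite e2 => h.
have [z0|z0] := lerP 0%R z.
  rewrite modz_small in h; last by lia.
  by rewrite ifT; lia.
have hz : (z %% Posz (2 * 2 ^ W)%N)%Z = (z + Posz (2 * 2 ^ W)%N)%R.
  rewrite -[in LHS](addrK (Posz (2 * 2 ^ W)%N) z) -modzDr subrK.
  by rewrite modz_small //; lia.
rewrite hz in h.
rewrite ifF; lia.
Qed.

(** * Prefix sums and copies of blocks at attractor positions *)

Definition prefix_sum (s : seq int) (i : nat) : int := (\sum_(x <- take i s) x)%R.

Lemma prefix_sumD s i l :
  (prefix_sum s (i + l) - prefix_sum s i = \sum_(x <- take l (drop i s)) x)%R.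
Proof. by rewrite /prefix_sum takeD big_cat /= addrAC subrr add0r. Qed.

Lemma psumE n (S : n.-tuple int) i : i <= n -> psum S i = prefix_sum S i.
Proof.
move=> le_in; rewrite /psum /prefix_sum (big_nth 0%R) size_takel ?size_tuple //.
rewrite big_mkord (big_ord_widen n (fun j => nth 0%R (take i S) j)) //.
by apply: eq_bigr => j ji; rewrite nth_take // (tnth_nth 0%R).
Qed.

Lemma psum_bound n (S : n.-tuple int) b i :
  (forall j : 'I_n, `|tnth S j| <= b) -> `|psum S i| <= n * b.
Proof.
move=> Sb; rewrite -lez_nat abszE /psum.
apply: le_trans (ler_norm_sum _ _ _) _.
rewrite big_mkcond /=.
apply: (@le_trans _ _ (\sum_(j < n) Posz b)%R).
  by apply: ler_sum => j _; case: ifP => // _; rewrite -abszE lez_nat.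
by rewrite sumr_const card_ord -mulr_natl PoszM natz.
Qed.

(* [i] starts a copy of the block of length [L] at [a], truncated where [s] ends,
   that contains [k] when it is nonempty. *)
Definition attracted (s : seq int) (K : pred nat) (L a k i : nat) : Prop :=
  [/\ k \in K, k.+1 - L <= i <= k
    & forall l, l <= L -> a + l <= size s ->
      i + l <= size s /\
      (prefix_sum s (a + l) - prefix_sum s a
       = prefix_sum s (i + l) - prefix_sum s i)%R].

(** The attractor property is applied to the block clipped at the end of the string; every
    truncation of the block is a prefix of that, so one copy serves all [l]. A block starting at or
    past the end is empty and is assigned [k0]. *)
Lemma attractor_copy n (S : n.-tuple int) (Gamma : {set 'I_n}) k0 L a :
    k0 \in Gamma -> string_attractor S Gamma -> 0 < L ->
  exists k i, attracted S [pred k | k \in map val (enum Gamma)] L a k i.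
Proof.
move=> k0G SG L0.
have inG k : k \in Gamma -> val k \in map val (enum Gamma).
  by move=> kG; rewrite mem_map ?mem_enum //; apply: val_inj.
have [an|na] := ltnP a n; last first.
  exists k0, k0; split; [exact: inG | lia | move=> l lL; rewrite size_tuple => aln].
  have -> : l = 0 by lia.
  by rewrite !addn0 !subrr; split=> //; apply: ltnW.
pose e := minn (a + L) n.
have en : e.-1 < n by lia.
have [|i [j [ij eqS [k kG kij]]]] := SG (Ordinal an) (Ordinal en).
  by rewrite /=; lia.
move: eqS; rewrite /substr /=.
have -> : e.-1.+1 - a = e - a by lia.
have jn := ltn_ord j; move=> eqS; have /(congr1 size) := eqS.
rewrite !size_takel ?size_drop ?size_tuple; try lia.
move=> ji; exists k, i; split; [exact: inG | lia | move=> l lL].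
rewrite size_tuple => aln; split; first by lia.
rewrite !prefix_sumD.
have -> : take l (drop a S) = take l (take (e - a) (drop a S)).
  by rewrite take_takel //; lia.
by rewrite -eqS take_takel //; lia.
Qed.

(** * Symbolic execution of the query program *)

(* Register 0: position relative to the current window; 1: accumulated sum;
   2: first node of the window; 3: block length; 4: arity; 5 to 7: the constants
   1, 2, 3. Cell 0 holds the length of the root blocks and cell 1 the arity;
   node [q] occupies the three cells from address [2 + 3 * q] on. *)
Definition psum_program : program :=
  [:: Const 5 1; Const 6 2; Const 7 3; Read 3 9; Read 4 5;
      Op OpDiv 8 0 3; Op OpMod 0 0 3; Op OpAdd 8 8 2; Op OpMul 8 8 7;
      Op OpAdd 8 8 6; Read 2 8; Op OpAdd 8 8 5; Read 10 8; Op OpAdd 0 0 10;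
      Op OpAdd 8 8 5; Read 10 8; Op OpAdd 1 1 10;
      JumpEq 3 5 20; Op OpDiv 3 3 4; Jump 5;
      Move 0 1; Halt].

Lemma iter_add W P k l s :
  iter (k + l) (step W P) s = iter l (step W P) (iter k (step W P) s).
Proof. by rewrite addnC iterD. Qed.

(** Registers 8 and 10 are scratch; register 9 is never written and stays 0, so it serves as the
    address of cell 0. *)
Definition reg_file (x acc b L t e v : nat) : seq nat :=
  [:: x; acc; b; L; t; 1; 2; 3; e; 0; v].

Lemma upd_nth (s : seq nat) r v : upd (nth 0 s) r v = nth 0 (set_nth 0 s r v).
Proof. by apply: boolp.funext => i; rewrite nth_set_nth. Qed.

(** With the registers kept as a list, simplification computes every read and write, and each
    instruction is executed by one rewrite. *)
Lemma iter_step W P k p s m :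
  iter k.+1 (step W P) (State p (nth 0 s) m) = iter k (step W P)
    match nth Halt P p with
    | Const r v => State p.+1 (nth 0 (set_nth 0 s r (v %% 2 ^ W))) m
    | Move r a => State p.+1 (nth 0 (set_nth 0 s r (nth 0 s a))) m
    | Op o r a b =>
        State p.+1 (nth 0 (set_nth 0 s r (eval_op W o (nth 0 s a) (nth 0 s b)))) m
    | Read r a => State p.+1 (nth 0 (set_nth 0 s r (nth 0 m (nth 0 s a)))) m
    | Write a b =>
        State p.+1 (nth 0 s)
          (if nth 0 s a < size m then set_nth 0 m (nth 0 s a) (nth 0 s b) else m)
    | Jump l => State l (nth 0 s) m
    | JumpLt a b l => State (if nth 0 s a < nth 0 s b then l else p.+1) (nth 0 s) m
    | JumpEq a b l => State (if nth 0 s a == nth 0 s b then l else p.+1) (nth 0 s) m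
    | Halt => State p (nth 0 s) m
    end.
Proof.
by rewrite iterSr /step /fetch [pc _]/=; case: (nth Halt P p) => *; rewrite ?upd_nth.
Qed.

Local Arguments iter : simpl never.
Local Arguments step : simpl never.
Local Arguments eval_op : simpl never.

Definition memory_of (L t N : nat) (base off val : nat -> nat) : seq nat :=
  [:: L; t] ++ mkseq (fun a => nth 0 [:: base (a %/ 3); off (a %/ 3); val (a %/ 3)]
                                  (a %% 3)) (3 * N).

Lemma nth_memory L t N base off val q r : q < N -> r < 3 ->
  nth 0 (memory_of L t N base off val) (2 + 3 * q + r)
  = nth 0 [:: base q; off q; val q] r.
Proof.
move=> qN r3; have -> : 2 + 3 * q + r = (q * 3 + r).+2 by lia.
rewrite /memory_of /= nth_mkseq; last by lia.
by rewrite divnMDl // divn_small // addn0 modnMDl modn_small.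
Qed.

Lemma nth_memory0 L t N base off val q : q < N ->
  nth 0 (memory_of L t N base off val) (2 + 3 * q) = base q.
Proof. by move=> qN; rewrite -[2 + _]addn0 nth_memory. Qed.

(** One level of the descent, instructions 5 to 16. The two bounds keep addresses and positions from
    wrapping around; only the accumulator is reduced. *)
Lemma loop_body W D acc b x L t e v :
    let q := b + x %/ L in
    let a := 2 + 3 * q in
    a + 2 < 2 ^ W -> x %% L + nth 0 D (a + 1) < 2 ^ W ->
  exists e' v',
    iter 12 (step W psum_program) (State 5 (nth 0 (reg_file x acc b L t e v)) D)
    = State 17 (nth 0 (reg_file (x %% L + nth 0 D (a + 1))
                            ((acc + nth 0 D (a + 2)) %% 2 ^ W)
                            (nth 0 D a) L t e' v')) D.
Proof.
move=> q a aW xW; exists (a + 2), (nth 0 D (a + 2)).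
have e1 : eval_op W OpDiv x L = x %/ L by rewrite /eval_op modn_small; lia.
have e2 : eval_op W OpMod x L = x %% L by rewrite /eval_op modn_small; lia.
have e3 : eval_op W OpAdd (x %/ L) b = q by rewrite /eval_op modn_small; lia.
have e4 : eval_op W OpMul q 3 = 3 * q by rewrite /eval_op modn_small; lia.
have e5 : eval_op W OpAdd (3 * q) 2 = a by rewrite /eval_op modn_small; lia.
have e6 : eval_op W OpAdd a 1 = a + 1 by rewrite /eval_op modn_small; lia.
have e7 : eval_op W OpAdd (a + 1) 1 = a + 2 by rewrite /eval_op modn_small; lia.
have e8 : eval_op W OpAdd (x %% L) (nth 0 D (a + 1)) = x %% L + nth 0 D (a + 1).
  by rewrite /eval_op modn_small.
rewrite /reg_file.
do 5 rewrite iter_step /= ?(e1, e2, e3, e4, e5).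
do 7 rewrite iter_step /= ?(e6, e7, e8).
reflexivity.
Qed.

(** * Descent through an abstract table of nodes *)

Section Navigation.

Variables (W t N : nat) (base off : nat -> nat) (val : nat -> int) (F : nat -> int).
(* [inv k b x p]: relative position [x] in the window of blocks of length [t ^ k]
   whose first node is [b] is position [p] of the string. *)
Variable inv : nat -> nat -> nat -> nat -> Prop.

Hypothesis t_gt1 : 1 < t.
Hypothesis N_small : 2 + 3 * N < 2 ^ W.
Hypothesis inv_bound : forall k b x p, inv k b x p ->
  b + x %/ t ^ k < N /\ x %% t ^ k + off (b + x %/ t ^ k) < 2 ^ W.
Hypothesis inv_step : forall k b x p, inv k.+1 b x p ->
  let q := b + x %/ t ^ k.+1 in
  exists2 p', inv k (base q) (x %% t ^ k.+1 + off q) p' & val q = (F p - F p')%R.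
Hypothesis inv_leaf : forall b x p, inv 0 b x p -> val (b + x) = F p.

Local Notation mem L := (memory_of L t N base off (word W \o val)).

(** The sum [acc + F p] is invariant, since the stored differences telescope. A level costs 12 steps
    for the body and 3 for the test, the division and the jump back; the last level costs 12 + 1. *)
Lemma loop_run L0 k : forall acc b x p e v, t ^ k < 2 ^ W -> inv k b x p ->
  exists r,
    iter (15 * k + 13) (step W psum_program)
         (State 5 (nth 0 (reg_file x (word W acc) b (t ^ k) t e v)) (mem L0))
    = State 20 (nth 0 r) (mem L0) /\ nth 0 r 1 = word W (acc + F p)%R.
Proof.
elim: k => [|k IHk] acc b x p e v tkW xI.
  have [qN xW] := inv_bound xI.
  have [||e' [v' run_body]] := @loop_body W (mem L0) (word W acc) b x (t ^ 0) t e v.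
  - by lia.
  - by rewrite nth_memory.
  rewrite !nth_memory // nth_memory0 //= in run_body.
  eexists; split.
    by rewrite (iter_add _ _ 12 1) run_body iter_step /=; reflexivity.
  by rewrite /= expn0 divn1 wordD (inv_leaf xI).
have [qN xW] := inv_bound xI.
have [||e' [v' run_body]] := @loop_body W (mem L0) (word W acc) b x (t ^ k.+1) t e v.
- by lia.
- by rewrite nth_memory.
rewrite !nth_memory // nth_memory0 //= in run_body.
have [p' p'I vq] := inv_step xI.
have tk1 : (t ^ k.+1 == 1) = false.
  by rewrite expnS muln_eq1; apply/negbTE/nandP; left; lia.
have tkW' : t ^ k < 2 ^ W.
  by apply: leq_ltn_trans tkW; rewrite leq_exp2l.
have tk : eval_op W OpDiv (t ^ k.+1) t = t ^ k.
  by rewrite /eval_op expnSr mulnK ?modn_small //; lia.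
rewrite (_ : 15 * k.+1 + 13 = 12 + (3 + (15 * k + 13))); last by lia.
rewrite iter_add run_body iter_add iter_step /= tk1 iter_step /= tk iter_step /=.
rewrite wordD vq.
have -> : (acc + F p = acc + (F p - F p') + F p')%R by rewrite -addrA subrK.
by apply: IHk p'I.
Qed.

Lemma answers_psum_program m x p : t ^ m < 2 ^ W -> x < 2 ^ W -> inv m 0 x p ->
  answers W psum_program (mem (t ^ m)) x (15 * m + 19) (sword W (word W (F p))).
Proof.
move=> tmW xW xI.
(* A node exists, so [2 ^ W] exceeds 5 and the constants 1, 2, 3 are loaded unreduced. *)
have [/(leq_ltn_trans (leq0n _)) N_gt0 _] := inv_bound xI.
have [r [run_r r1]] := @loop_run (t ^ m) m 0%R 0 x p 0 0 tmW xI.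
have initE : init W (mem (t ^ m)) x
    = State 0 (nth 0 (x :: nseq 10 0)) (mem (t ^ m)).
  rewrite /init modn_small //; congr State; apply: boolp.funext => -[|j] //.
  by rewrite [RHS](nth_nseq 0 10) if_same.
have start : iter 5 (step W psum_program) (init W (mem (t ^ m)) x)
    = State 5 (nth 0 (reg_file x (word W 0) 0 (t ^ m) t 0 0)) (mem (t ^ m)).
  rewrite initE word0 iter_step /= modn_small; last by lia.
  rewrite iter_step /= modn_small; last by lia.
  rewrite iter_step /= modn_small; last by lia.
  by do 2 rewrite iter_step /=.
have runE : run W psum_program (mem (t ^ m)) x (15 * m + 19)
    = State 21 (nth 0 (set_nth 0 r 0 (nth 0 r 1))) (mem (t ^ m)).
  (* Five steps of setup, the loop, and the move of the accumulator to register 0. *)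
  rewrite /run (_ : 15 * m + 19 = 5 + ((15 * m + 13) + 1)); last by lia.
  by rewrite iter_add start iter_add run_r iter_step.
rewrite /answers runE; split=> //.
by rewrite /= nth_set_nth /= r1 add0r.
Qed.

End Navigation.

(** * Layout of the nodes built from the attractor *)

Section DataStructure.

Variables (n : nat) (S : n.-tuple int) (G : seq nat) (W t m : nat).
Variable copy : nat * nat -> nat * nat.

Hypothesis copyP : forall La, 0 < La.1 ->
  attracted S [pred k | k \in G] La.1 La.2 (copy La).1 (copy La).2.
Hypothesis t_gt1 : 1 < t.

Let g := size G.
(** Positions range from 0 to [n] inclusive, hence the successor. *)
Let roots := (n %/ t ^ m).+1.
Definition node_count := roots + m * g * (2 * t).

Hypothesis N_small : 2 + 3 * node_count < 2 ^ W.
Hypothesis block_small : 2 * t ^ m < 2 ^ W.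

(* After the root blocks come, for [k < m], the windows of the attractor positions
   [nth 0 G j], with [2 * t] blocks of length [t ^ k] each. *)
Definition node_exp (q : nat) : nat :=
  if q < roots then m else (q - roots) %/ (2 * t) %/ g.

(** Leftmost start of a block of length [t ^ k] containing [p]; truncated subtraction clips it at
    the left end of the string. *)
Definition region_start (p k : nat) : nat := p.+1 - t ^ k.

Definition node_start (q : nat) : nat :=
  if q < roots then q * t ^ m else
    region_start (nth 0 G ((q - roots) %/ (2 * t) %% g)) (node_exp q).+1
    + (q - roots) %% (2 * t) * t ^ node_exp q.

Definition child_base (k j : nat) : nat := roots + (k * g + j) * (2 * t).

Definition node_copy (q : nat) : nat * nat := copy (t ^ node_exp q, node_start q).

Definition node_base (q : nat) : nat :=
  if node_exp q is k.+1 then child_base k (index (node_copy q).1 G) else 0.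

Definition node_off (q : nat) : nat :=
  (node_copy q).2 - region_start (node_copy q).1 (node_exp q).

Definition node_val (q : nat) : int :=
  if node_exp q is k.+1
  then (prefix_sum S (node_start q) - prefix_sum S (node_copy q).2)%R
  else prefix_sum S (node_start q).

Definition located (k b x p : nat) : Prop :=
  let q := b + x %/ t ^ k in
  [/\ p <= n, k <= m, q < node_count, node_exp q = k
    & node_start q + x %% t ^ k = p].

Lemma block_length_gt0 k : 0 < t ^ k.
Proof. by rewrite expn_gt0; lia. Qed.

Lemma node_copyP q :
  attracted S [pred k | k \in G] (t ^ node_exp q) (node_start q)
            (node_copy q).1 (node_copy q).2.
Proof. exact: (@copyP (_, _) (block_length_gt0 _)). Qed.

Lemma node_exp_le q : q < node_count -> node_exp q <= m.
Proof.
rewrite /node_exp /node_count => qN; case: (ltnP q roots) => // rq.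
have [->|g0] := posnP g; first by rewrite divn0.
rewrite -ltnS ltn_divLR // ltn_divLR; last by lia.
have : m * g * (2 * t) <= m.+1 * g * (2 * t) by rewrite !leq_mul.
have : 0 < m.+1 * g * (2 * t) by rewrite !muln_gt0; lia.
lia.
Qed.

(** A copy has to reach its attractor position, so it starts among the last [t ^ node_exp q]
    positions up to it. *)
Lemma node_off_lt q : node_off q < t ^ node_exp q.
Proof.
have [_ + _] := node_copyP q; rewrite /node_off /region_start.
have := block_length_gt0 (node_exp q); lia.
Qed.

Lemma child_base_lt k j c : k < m -> j < g -> c < 2 * t ->
  child_base k j + c < node_count.
Proof.
move=> km jg ct; rewrite /child_base /node_count -addnA ltn_add2l.
apply: (@leq_trans ((k * g + j).+1 * (2 * t))); first by rewrite mulSn; lia.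
rewrite leq_mul2r; apply/orP; right.
apply: (@leq_trans (k.+1 * g)); first by rewrite mulSn; lia.
by rewrite leq_mul2r km orbT.
Qed.

(** Past the roots, a node index is the mixed-radix numeral of digits [k], [j], [c] with radices [g]
    and [2 * t]. *)
Lemma child_exp k j c : j < g -> c < 2 * t -> node_exp (child_base k j + c) = k.
Proof.
move=> jg ct; rewrite /node_exp /child_base ifF; last by lia.
rewrite -addnA addKn divnMDl; last by lia.
by rewrite (divn_small ct) addn0 divnMDl ?(divn_small jg) ?addn0 //; lia.
Qed.

Lemma child_start k j c : j < g -> c < 2 * t ->
  node_start (child_base k j + c)
  = region_start (nth 0 G j) k.+1 + c * t ^ k.
Proof.
move=> jg ct; rewrite /node_start child_exp // /child_base ifF; last by lia.
rewrite -addnA addKn divnMDl; last by lia.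
by rewrite (divn_small ct) addn0 !modnMDl (modn_small jg) (modn_small ct).
Qed.

Lemma located_root i : i <= n -> located m 0 i i.
Proof.
move=> le_in; have qr : i %/ t ^ m < roots by rewrite ltnS leq_div2r.
split=> //; rewrite ?add0n.
- by rewrite /node_count; lia.
- by rewrite /node_exp qr.
- by rewrite /node_start qr -divn_eq.
Qed.

Lemma located_bound k b x p : located k b x p ->
  b + x %/ t ^ k < node_count /\ x %% t ^ k + node_off (b + x %/ t ^ k) < 2 ^ W.
Proof.
case=> _ km qN qk _; split=> //.
have := node_off_lt (b + x %/ t ^ k); rewrite qk => off_lt.
have xk : x %% t ^ k < t ^ k by rewrite ltn_mod block_length_gt0.
have : t ^ k <= t ^ m by rewrite leq_exp2l.
lia.
Qed.

Lemma located_step k b x p : located k.+1 b x p ->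
  let q := b + x %/ t ^ k.+1 in
  exists2 p', located k (node_base q) (x %% t ^ k.+1 + node_off q) p'
    & node_val q = (prefix_sum S p - prefix_sum S p')%R.
Proof.
move=> [pn km qN qk qp] q; rewrite -/q in qN qk qp.
set l := x %% t ^ k.+1 in qp *.
have lk : l < t ^ k.+1 by rewrite ltn_mod block_length_gt0.
have off_lt := node_off_lt q.
have := node_copyP q; rewrite /node_off /node_base /node_val qk in off_lt *.
case: (node_copy q) => r i /= in off_lt *; case=> rG ir /(_ l (ltnW lk)).
rewrite size_tuple qp => /(_ pn) [iln PSe].
have rg : index r G < g by rewrite index_mem.
exists (i + l).
  set x' := l + _; set c := x' %/ t ^ k.
  (* Both [l] and the offset are below [t ^ k.+1], so their sum stays inside the window of length
     [2 * t * t ^ k]. *)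
  have ct : c < 2 * t.
    by rewrite ltn_divLR ?block_length_gt0 // -mulnA -expnS; rewrite /x'; lia.
  split=> //; rewrite -/c ?child_exp ?child_start ?child_base_lt //.
  - by apply: ltnW.
  (* The window starts no later than [i], so the truncated subtraction in the offset is exact. *)
  - rewrite nth_index // -addnA -divn_eq /x' /region_start; lia.
by lia.
Qed.

Lemma located_leaf b x p : located 0 b x p -> node_val (b + x) = prefix_sum S p.
Proof.
case=> _ _; rewrite expn0 divn1 modn1 addn0 => _ q0 <-.
by rewrite /node_val q0.
Qed.

Definition attractor_memory : seq nat :=
  memory_of (t ^ m) t node_count node_base node_off (word W \o node_val).

Lemma size_attractor_memory : size attractor_memory = 2 + 3 * node_count.
Proof. by rewrite /attractor_memory /memory_of size_cat size_mkseq. Qed.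

Lemma is_memory_attractor_memory : t < 2 ^ W -> is_memory W attractor_memory.
Proof.
move=> tW; apply/allP => w; rewrite mem_cat => /orP[|/mapP[a]].
  by rewrite !inE => /orP[] /eqP-> //; lia.
rewrite mem_iota add0n => /andP[_ aN] ->.
have qN : a %/ 3 < node_count by rewrite ltn_divLR // mulnC.
have qm := node_exp_le qN.
have : t ^ node_exp (a %/ 3) <= t ^ m by rewrite leq_exp2l.
have := node_off_lt (a %/ 3).
case: (a %% 3) (ltn_pmod a (isT : 0 < 3)) => [|[|[|//]]] _ /=; try lia; last first.
  by rewrite word_lt.
move=> _ _; apply: (@leq_ltn_trans node_count); last by lia.
rewrite /node_base; have [rG _ _] := node_copyP (a %/ 3).
case: (node_exp (a %/ 3)) qm => // k km.
by rewrite -[child_base _ _]addn0 ltnW // child_base_lt ?index_mem //; lia.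
Qed.

Lemma answers_attractor_memory b i : t < 2 ^ W -> n < 2 ^ W -> 0 < W ->
    (forall j : 'I_n, `|tnth S j| <= b) -> n * b < 2 ^ W.-1 -> i <= n ->
  answers W psum_program attractor_memory i (15 * m + 19) (psum S i).
Proof.
move=> tW nW W0 Sb nbW le_in.
rewrite -[psum S i](@sword_word W) //; last first.
  by apply: leq_ltn_trans nbW; apply: psum_bound.
rewrite psumE //.
apply: (@answers_psum_program _ _ _ _ _ _ _ located) => //.
- exact: located_bound.
- exact: located_step.
- exact: located_leaf.
- by lia.
- by lia.
- exact: located_root.
Qed.

End DataStructure.

(** * Choice of the depth, and bounds on sizes *)

Lemma exists_depth n g t : 1 < t -> 0 < g -> g < n ->
  exists2 m, n <= g * t ^ m.+1 & g * t ^ m < n.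
Proof.
move=> t1 g0 gn.
have ex : exists m, n <= g * t ^ m.
  exists n; apply: leq_trans (ltnW (ltn_expl n t1)) _.
  by rewrite leq_pmull.
(* Exponent 0 would give [n <= g], so the least exponent is a successor. *)
case: (ex_minnP ex) => -[|m] nm minm; first by move: nm; rewrite expn0; lia.
exists m => //; rewrite ltnNge; apply/negP => /minm; lia.
Qed.

(** Everything is polynomial in [n]: [m < t ^ m < n] and [t <= n] give [t ^ m.+1 <= n ^ 2] and at
    most [n ^ 3] window nodes, while [2 * n ^ c.+1 <= n ^ (c + 2)] leaves room for the sign bit. *)
Lemma word_size_bounds n g t m c W :
    1 < t -> 0 < g -> g * 2 <= n -> t <= n -> n <= g * t ^ m.+1 ->
    g * t ^ m < n -> n ^ (c + 10) <= 2 ^ W ->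
  [/\ 2 + 3 * ((n %/ t ^ m.+1).+1 + m.+1 * g * (2 * t)) < 2 ^ W,
      2 * t ^ m.+1 < 2 ^ W, n * n ^ c < 2 ^ W.-1 & 0 < W].
Proof.
move=> t1 g0 gn tn nm mn nW.
have n2 : 2 <= n by lia.
have n0 : 0 < n by lia.
have n8W : n ^ 8 <= 2 ^ W by apply: leq_trans nW; rewrite leq_exp2l //; lia.
have W0 : 0 < W.
  case: W n8W {nW} => //; rewrite expn0 leqNgt -[1](expn0 n).
  by rewrite ltn_exp2l.
have tmn : t ^ m < n by nia.
have tSm : t ^ m.+1 <= n ^ 2 by rewrite expnS -mulnn leq_mul // ltnW.
have mn' : m.+1 <= n by apply: leq_ltn_trans tmn; apply: ltnW; apply: ltn_expl.
have n3 : n ^ 3 < 2 ^ W by apply: leq_trans n8W; rewrite ltn_exp2l.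
split=> //.
- have q1 : n %/ t ^ m.+1 <= n by apply: leq_div.
  have q2 : m.+1 * g * (2 * t) <= n ^ 3.
    have -> : m.+1 * g * (2 * t) = m.+1 * (g * 2 * t) by rewrite -!mulnA.
    by rewrite !expnS expn0 muln1 !leq_mul.
  have e4 : n ^ 6 = n ^ 3 * n ^ 3 by rewrite -expnD.
  have e5 : n ^ 3 < n ^ 6 by rewrite ltn_exp2l.
  have h8 : 8 <= n ^ 3 by rewrite (_ : 8 = 2 ^ 3) // leq_exp2r.
  have h1 : n <= n ^ 3 by rewrite -[X in X <= _]expn1 leq_exp2l.
  have h6 : n ^ 6 < 2 ^ W by apply: leq_trans n8W; rewrite ltn_exp2l.
  nia.
- apply: leq_ltn_trans n3; rewrite (expnS n 2); apply: leq_mul => //.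
- rewrite -expnS -(@ltn_pmul2l 2) // -expnS prednK //.
  apply: leq_trans nW; apply: (@leq_ltn_trans (n ^ (c + 2))).
    by rewrite addn2 (expnS n c.+1) leq_mul2r n2 orbT.
  by rewrite ltn_exp2l //; lia.
Qed.

(** There are at most [g + 1] roots, and 14 = 5 + 3 + 6 collects the constant, the roots and the
    windows. *)
Lemma size_bound n g t m : 0 < t -> 0 < g -> n <= g * t ^ m.+1 ->
  2 + 3 * ((n %/ t ^ m.+1).+1 + m.+1 * g * (2 * t)) <= 14 * (m.+1 * g * t).
Proof.
move=> t0 g0 nm; have q_le : n %/ t ^ m.+1 <= g.
  by apply: leq_trans (leq_div2r _ nm) _; rewrite mulnK // expn_gt0 t0.
have : g <= m.+1 * g * t by rewrite mulnAC leq_pmull ?muln_gt0.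
by rewrite mulnCA; lia.
Qed.

(** * Logarithmic estimates and final assembly *)

Local Open Scope ring_scope.

Lemma expn_le_of_logb (R : realType) (n W k : nat) : (0 < n)%N ->
  k%:R * logb 2 (n%:R : R) <= W%:R -> (n ^ k <= 2 ^ W)%N.
Proof.
move=> n0; have ln2 : 0 < ln (2 : R) by rewrite ln_gt0 // ltr1n.
rewrite /logb mulrA ler_pdivrMr // => kW.
rewrite -(ler_nat R) !natrX -ler_ln ?posrE ?exprn_gt0 ?ltr0n //.
by rewrite !lnXn ?ltr0n // -[leLHS]mulr_natl -[leRHS]mulr_natl.
Qed.

(** Rounding [tau] down costs a factor 2: [tau < t + 1 <= t ^ 2] gives [m <= 2 * logb tau x], and
    [1 <= logb tau x] absorbs the extra level. *)
Lemma depth_le_logb (R : realType) (x tau : R) (t m : nat) :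
    (1 < t)%N -> tau < t.+1%:R -> 2 <= tau -> tau <= x -> (t ^ m)%:R <= x ->
  1 <= logb tau x /\ m.+1%:R <= 3 * logb tau x.
Proof.
move=> t1 tau_t tau2 tau_x tm_x.
have tau0 : 0 < tau by lra.
have x0 : 0 < x by lra.
have lntau : 0 < ln tau by rewrite ln_gt0; lra.
have lnx : ln tau <= ln x by rewrite ler_ln.
have t0 : (0 : R) < t%:R by rewrite ltr0n; lia.
have mt : m%:R * ln (t%:R : R) <= ln x.
  by rewrite mulr_natl -lnXn // -natrX ler_ln // posrE natrX exprn_gt0.
have ltau : ln tau <= 2 * ln (t%:R : R).
  rewrite mulr_natl -lnXn // ler_ln ?posrE ?exprn_gt0 //.
  by rewrite -natrX; apply: le_trans (ltW tau_t) _; rewrite ler_nat; nia.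
split; rewrite /logb; first by rewrite ler_pdivlMr // mul1r.
rewrite mulrA ler_pdivlMr // -natr1 mulrDl mul1r.
have m0 : (0 : R) <= m%:R by [].
nra.
Qed.

Theorem theorem18 (R : realType) (c : nat) :
  exists k0 : R, forall k1 : R,
  exists (P : program) (C : R),
  forall (n W : nat) (S : n.-tuple int) (Gamma : {set 'I_n}) (tau : R),
    k0 * logb 2 n%:R <= W%:R <= k1 * logb 2 n%:R ->
    (forall j : 'I_n, (`|tnth S j| <= n ^ c)%N) ->
    string_attractor S Gamma ->
    2 <= tau <= n%:R / #|Gamma|%:R ->
    exists D : seq nat,
      [/\ is_memory W D,
          (size D)%:R
            <= C * (tau * #|Gamma|%:R * logb tau (n%:R / #|Gamma|%:R))
        & forall i : nat, (1 <= i <= n)%N ->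
            exists2 t : nat,
              t%:R <= C * logb tau (n%:R / #|Gamma|%:R)
            & answers W P D i t (psum S i)].
Proof.
(* The constant 102 dominates both 14 * 3 = 42 for the size and 15 * 3 + 19 = 64 for the time. *)
exists (c + 10)%:R => k1; exists psum_program, 102.
move=> n W S Gamma tau /andP[k0W _] Sb SG /andP[tau2 tau_le].
set g := #|Gamma| in tau_le *; set x := n%:R / g%:R in tau_le *.
have g0 : (0 < g)%N.
  (* For an empty [Gamma] the quotient by 0 is 0, against [2 <= tau]. *)
  by rewrite lt0n; apply/eqP => g0; move: tau_le; rewrite /x g0 invr0 mulr0; lra.
have gR : (0 : R) < g%:R by rewrite ltr0n.
have gn : (g * 2 <= n)%N.
  rewrite -(ler_nat R) natrM mulrC -ler_pdivlMr //; exact: le_trans tau_le.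
pose t := Num.truncn tau.
have tau0 : 0 <= tau by lra.
have t1 : (1 < t)%N by rewrite truncn_ge_nat.
have t_tau : t%:R <= tau by rewrite truncn_le.
have tau_t : tau < t.+1%:R by rewrite truncnS_gt.
have tn : (t <= n)%N.
  have : (t * g <= n)%N.
    rewrite -(ler_nat R) natrM -ler_pdivlMr //; exact: le_trans t_tau tau_le.
  nia.
have [|m nm mn] := @exists_depth n g t t1 g0; first by lia.
have n0 : (0 < n)%N := leq_trans (ltnW t1) tn.
have nW := expn_le_of_logb n0 k0W.
have [N_small block_small val_small W0] := word_size_bounds t1 g0 gn tn nm mn nW.
have [lg1 mlg] : 1 <= logb tau x /\ m.+1%:R <= 3 * logb tau x.
  apply: depth_le_logb t1 tau_t tau2 tau_le _.
  by rewrite ler_pdivlMr // -natrM ler_nat mulnC ltnW.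
set lg := logb tau x in lg1 mlg *.
have n_lt : (n < 2 ^ W)%N.
  apply: leq_trans nW; rewrite -[X in (X < _)%N]expn1 ltn_exp2l ?ltn_addl //.
  exact: leq_trans t1 tn.
have tW := leq_ltn_trans tn n_lt.
have [k kG] : exists k, k \in Gamma by apply/card_gt0P.
pose G := [seq val i | i <- enum Gamma].
have sG : size G = g by rewrite size_map -cardE.
(* One copy is fixed for each pair of length and start; pairs of length 0 get a dummy. *)
have /boolp.choice[copy copyP] : forall La : nat * nat, exists r : nat * nat,
    (0 < La.1)%N -> attracted S [pred k | k \in G] La.1 La.2 r.1 r.2.
  move=> [L a]; have [->|L0] := posnP L; first by exists (0, 0)%N.
  by have [r [i riP]] := attractor_copy a kG SG L0; exists (r, i).
exists (attractor_memory S G W t m.+1 copy); split.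
- by apply: is_memory_attractor_memory; rewrite // /node_count sG.
- have sizeD : (size (attractor_memory S G W t m.+1 copy) <= 14 * (m.+1 * g * t))%N.
    by rewrite size_attractor_memory /node_count sG size_bound // ltnW.
  move: sizeD; rewrite -(ler_nat R) => /le_trans; apply.
  rewrite !natrM.
  have : m.+1%:R * g%:R * t%:R <= 3 * lg * g%:R * tau by rewrite !ler_pM // mulr_ge0.
  have lg0 : 0 <= lg by lra.
  have : 0 <= tau * g%:R * lg by do 2 apply: mulr_ge0 => //.
  lra.
- move=> i /andP[_ le_in]; exists (15 * m.+1 + 19)%N.
    rewrite natrD natrM; lra.
  by apply: answers_attractor_memory Sb _ _ => //; rewrite ?/node_count ?sG //.
Qed.
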